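(* Let $k$ be a positive integer. If the set $\{1, 8k^2, 8k^2+1, d\}$ is a $D(-8k^2)$-quadruple, then $d = 32k^2+1$, and in that case $24k^2+1$ is a perfect square.
   Context: Let $n$ be a nonzero integer. A set of $m$ (distinct) positive integers $\{a_1, \dots, a_m\}$ is called a $D(n)$-$m$-tuple if $a_i a_j + n$ is a perfect square (the square of an integer, $0$ allowed) for all $1 \leq i < j \leq m$. A $D(n)$-quadruple is a $D(n)$-$4$-tuple. *)

(* Defs.v *)
From mathcomp Require Import all_boot all_order all_algebra.
Set Implicit Arguments. Unset Strict Implicit. Unset Printing Implicit Defensive.
Import Order.TTheory GRing.Theory Num.Theory.
Local Open Scope ring_scope.

Definition is_square (x : int) : Prop := exists m : int, x = m * m.

Definition D_tuple (n : int) (m : nat) (s : seq int) : Prop :=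
  [/\ n != 0, size s = m, uniq s, all (fun a => 0 < a) s &
      forall i j : nat, (i < j)%N -> (j < size s)%N ->
        is_square (nth 0 s i * nth 0 s j + n)].

Definition D_quadruple (n : int) (s : seq int) : Prop := D_tuple n 4 s.

(* Main.v *)
Require Import Defs.
From mathcomp Require Import all_boot all_order all_algebra.
From mathcomp Require Import zify ring.
Import Order.TTheory GRing.Theory Num.Theory.
Local Open Scope ring_scope.

(* Put N = 8 k^2. The element d satisfies d = 2 z^2 + 1, d - N = x^2 and
   w^2 = 2 (N + 1) z^2 + 1. Since 2 (N + 1) = (4 k)^2 + 2, descent on this Pell
   equation gives z = 4 k A B where either
     (N + 1) A^2 = N B^2 + 1, or A^2 = N (N + 1) B^2 + 1.
   In each case x^2 splits into two coprime factors, one of which is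
     (4 k B)^2 + N + 1, respectively (4 k B)^2 + 1
   (2 N is a square). This factor is a square, so |B| <= k, respectively B = 0.
   The former forces A^2 = B^2 = 1, hence d = 32 k^2 + 1; the latter gives
   the excluded d = 1. *)

(** Proves an equation modulo a hypothesis [l = r]: [c] is the cofactor, and [ring] checks the
    rest. *)
Lemma eq_of_multiple (c : int) {l r a b : int} :
  l = r -> a - b = c * (l - r) -> a = b.
Proof. by move=> -> /eqP; rewrite subrr mulr0 subr_eq0 => /eqP. Qed.

(** Here v = g^2 for g = gcd(v, x): g^2 combines v^2, v x and x^2 = u v, and conversely v = a x^2 +
    b v^2 when a u + b v = 1. *)
Lemma coprimez_mul_square (u v x : int) :
  coprimez u v -> 0 <= v -> u * v = x ^+ 2 -> exists q, v = q ^+ 2.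
Proof.
move=> /coprimezP[[a b] /= ab1] v_ge0 uvx; exists (gcdz v x).
have [c [d gE]] := Bezoutz v x.
have : (v %| gcdz v x ^+ 2)%Z.
  apply/dvdzP; exists (c ^+ 2 * v + 2 * c * d * x + d ^+ 2 * u).
  by rewrite -gE; apply: (eq_of_multiple (- d ^+ 2) uvx); ring.
have : (gcdz v x ^+ 2 %| v)%Z.
  have vE : v = a * x ^+ 2 + b * v ^+ 2.
    by rewrite -uvx; apply: (eq_of_multiple (- v) ab1); ring.
  rewrite [X in (_ %| X)%Z]vE.
  by apply: rpredD; apply: dvdz_mull; apply: dvdz_exp2r;
    rewrite ?dvdz_gcdl ?dvdz_gcdr.
rewrite !dvdzE abszX => g_v v_g.
have /eqP v_eq : `|v|%N == (`|gcdz v x| ^ 2)%N by rewrite eqn_dvd v_g -abszX.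
by rewrite -[LHS]gez0_abs // v_eq -abszX gez0_abs // sqr_ge0.
Qed.

(* With N = 8 k^2 and c = sqrt (N + 1), one has w = T_(2j)(c) for some j;
   the first case is j odd, where A = T_j(c) / c and B = U_(j-1)(c), and the
   second is j even, where A = T_j(c) and B = U_(j-1)(c) / c. *)
Lemma pell_param (k w z : int) :
  0 < k -> 0 <= w -> 0 <= z -> w ^+ 2 = 2 * (8 * k ^+ 2 + 1) * z ^+ 2 + 1 ->
  exists A B : int, z = 4 * k * A * B /\
    ((w = 16 * k ^+ 2 * B ^+ 2 + 1 /\
      (8 * k ^+ 2 + 1) * A ^+ 2 = 8 * k ^+ 2 * B ^+ 2 + 1) \/
     (w = 16 * k ^+ 2 * (8 * k ^+ 2 + 1) * B ^+ 2 + 1 /\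
      A ^+ 2 = 8 * k ^+ 2 * (8 * k ^+ 2 + 1) * B ^+ 2 + 1)).
Proof.
move=> k_gt0.
have [n] := ubnP `|z|%N; elim: n w z => // n IHn w z zn w_ge0 z_ge0 wz.
have [z0|z_neq0] := eqVneq z 0.
  exists 1, 0; split; first by rewrite z0; ring.
  right; split; last by ring.
  suff : w = 1 by move=> ->; ring.
  by rewrite z0 in wz; nia.
have z_gt0 : 0 < z by lia.
have w_gt : 4 * k * z < w by nia.
(* Otherwise 2 z^2 < 8 k z, which puts w strictly between 4 k z and 4 k z + 1. *)
have z_ge : 4 * k <= z.
  rewrite leNgt; apply/negP => z_lt.
  suff : w < 4 * k * z + 1 by lia.
  by nia.
(* Division of w + z sqrt(16 k^2 + 2) by the unit 16 k^2 + 1 + 4 k sqrt(16 k^2 + 2). *)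
set w' := (16 * k ^+ 2 + 1) * w - 4 * k * (16 * k ^+ 2 + 2) * z.
set z' := (16 * k ^+ 2 + 1) * z - 4 * k * w.
have ew : w = (16 * k ^+ 2 + 1) * w' + 4 * k * (16 * k ^+ 2 + 2) * z'.
  by rewrite /w' /z'; ring.
have ez : z = 4 * k * w' + (16 * k ^+ 2 + 1) * z' by rewrite /w' /z'; ring.
have wz' : w' ^+ 2 = 2 * (8 * k ^+ 2 + 1) * z' ^+ 2 + 1.
  transitivity (w ^+ 2 - (2 * (8 * k ^+ 2 + 1) * z ^+ 2 + 1)
     + 2 * (8 * k ^+ 2 + 1) * z' ^+ 2 + 1); last by rewrite wz; ring.
  by rewrite /w' /z'; ring.
have z'_ge0 : 0 <= z'.
  rewrite /z' subr_ge0 -(@ler_pXn2r _ 2) ?nnegrE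
      ?(addr_ge0, mulr_ge0, sqr_ge0, ltW k_gt0) //.
  have -> : ((16 * k ^+ 2 + 1) * z) ^+ 2 =
      (4 * k * w) ^+ 2 + (z ^+ 2 - (4 * k) ^+ 2).
    by apply: (eq_of_multiple (- (16 * k ^+ 2)) wz); ring.
  by rewrite lerDl subr_ge0 lerXn2r ?nnegrE ?mulr_ge0 ?(ltW k_gt0).
have z'_lt : z' < z.
  have -> : z' = z + 4 * k * (4 * k * z - w) by rewrite /z'; ring.
  by rewrite gtrDl pmulr_rlt0 ?subr_lt0 ?mulr_gt0.
have w'_ge0 : 0 <= w'.
  rewrite /w' subr_ge0 -(@ler_pXn2r _ 2) ?nnegrE
      ?(addr_ge0, mulr_ge0, sqr_ge0, ltW k_gt0) //.
  have -> : ((16 * k ^+ 2 + 1) * w) ^+ 2 =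
      (4 * k * (16 * k ^+ 2 + 2) * z) ^+ 2 +
      (w ^+ 2 + 32 * k ^+ 2 * (8 * k ^+ 2 + 1)).
    by apply: (eq_of_multiple (16 * k ^+ 2 * (16 * k ^+ 2 + 2)) wz); ring.
  by rewrite lerDl addr_ge0 ?mulr_ge0 ?addr_ge0 ?mulr_ge0 ?(ltW k_gt0).
have [|A [B [zAB wAB]]] := IHn w' z' _ w'_ge0 z'_ge0 wz'; first by lia.
(* The unit is (sqrt(N + 1) + sqrt(N))^2. Multiplication by its square root sends A sqrt(N + 1) + B
   sqrt(N) to the form A + B sqrt(N (N + 1)) and conversely, so the two cases alternate. *)
case: wAB => [] [wB AB].
  exists ((8 * k ^+ 2 + 1) * A + 8 * k ^+ 2 * B), (A + B).
  rewrite ez ew zAB wB; split; [|right; split].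
  - by apply: (eq_of_multiple (- (4 * k)) AB); ring.
  - by apply: (eq_of_multiple (- (16 * k ^+ 2)) AB); ring.
  - by apply: (eq_of_multiple 1 AB); ring.
exists (A + 8 * k ^+ 2 * B), (A + (8 * k ^+ 2 + 1) * B).
rewrite ez ew zAB wB; split; [|left; split].
- by apply: (eq_of_multiple (- (4 * k)) AB); ring.
- by apply: (eq_of_multiple (- (16 * k ^+ 2)) AB); ring.
- by apply: (eq_of_multiple 1 AB); ring.
Qed.

Lemma double_square (k d y : int) : 0 < k ->
  8 * k ^+ 2 * d = y ^+ 2 -> exists z, 0 <= z /\ d = 2 * z ^+ 2.
Proof.
move=> k_gt0 dy.
have /dvdzP[t yE] : (2 * k %| y)%Z.
  rewrite -(dvdz_pexp2r _ _ (k := 2)) //; apply/dvdzP; exists (2 * d).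
  by rewrite -dy; ring.
have td : t ^+ 2 = 2 * d.
  apply: (@mulfI _ (4 * k ^+ 2)); first by nia.
  by apply: (eq_of_multiple (-1) dy); rewrite yE; ring.
have /dvdzP[z tE] : (2 %| t)%Z.
  have : (2 %| t ^+ 2)%Z by rewrite td dvdz_mulr.
  by rewrite !dvdzE abszX Euclid_dvdX // andbT.
exists `|z|; split; first exact: normr_ge0.
rewrite real_normK ?num_real //.
by apply: (@mulfI _ 2) => //; rewrite -td tE; ring.
Qed.

Lemma sqr_gap (m q : int) : m ^+ 2 < q ^+ 2 -> m ^+ 2 + 2 * `|m| + 1 <= q ^+ 2.
Proof.
move=> mq.
have q_gt : `|m| < `|q|.
  by rewrite -(@ltr_pXn2r _ 2) ?nnegrE // !real_normK ?num_real.
have : (`|m| + 1) ^+ 2 <= `|q| ^+ 2.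
  by rewrite lerXn2r ?nnegrE ?addr_ge0 // lezD1.
by rewrite sqrrD mulr1 expr1n !real_normK ?num_real //; lia.
Qed.

Lemma sqr_succ_eq_sqr (m q : int) : m ^+ 2 + 1 = q ^+ 2 -> m = 0.
Proof.
move=> mq; have := @sqr_gap m q; rewrite -mq ltrDl => /(_ isT).
by lia.
Qed.

(** A square above (4 k B)^2 exceeds it by at least 8 k |B| + 1; here the excess is 8 k^2 + 1. *)
Lemma normr_le_of_sqr_sum (k B q : int) :
  0 < k -> (4 * k * B) ^+ 2 + 8 * k ^+ 2 + 1 = q ^+ 2 -> `|B| <= k.
Proof.
move=> k_gt0 qE; rewrite leNgt; apply/negP => k_lt.
have k2_gt0 : 0 < k ^+ 2 by rewrite exprn_gt0.
have mE : `|4 * k * B| = 4 * k * `|B| by rewrite !normrM (gtr0_norm k_gt0).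
have k_le : k ^+ 2 < k * `|B| by rewrite expr2 ltr_pM2l.
have := @sqr_gap (4 * k * B) q; rewrite -qE mE.
by rewrite -addrA ltrDl; lia.
Qed.

(** As A^2 - 1 = 8 k^2 (B^2 - A^2), A^2 < B^2 would give A^2 > 8 k^2 >= B^2, while B^2 <= A^2 forces
    A^2 <= 1. *)
Lemma small_pell_solution (k A B : int) : 0 < k -> `|B| <= k ->
  (8 * k ^+ 2 + 1) * A ^+ 2 = 8 * k ^+ 2 * B ^+ 2 + 1 ->
  A ^+ 2 = 1 /\ B ^+ 2 = 1.
Proof.
move=> k_gt0 B_le AB.
have: B ^+ 2 <= k ^+ 2 by clear -B_le; nia.
have: 0 <= A ^+ 2 by exact: sqr_ge0.
have: 0 <= B ^+ 2 by exact: sqr_ge0.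
have: 0 < k ^+ 2 by rewrite exprn_gt0.
move: AB; move: (k ^+ 2) (A ^+ 2) (B ^+ 2) => K a b {k_gt0 B_le}.
move=> ab K_gt0 b_ge0 a_ge0 bK.
by have [le_ba|lt_ab] := leP b a; [split; nia | nia].
Qed.

Theorem theorem2 (k d : int) (hk : 0 < k) :
  D_quadruple (- (8 * k ^+ 2)) [:: 1; 8 * k ^+ 2; 8 * k ^+ 2 + 1; d] ->
  d = 32 * k ^+ 2 + 1 /\ is_square (24 * k ^+ 2 + 1).
Proof.
case=> _ _ uniq_s _ sq.
have [x xE] := sq 0 3 isT isT.
have [y yE] := sq 1 3 isT isT.
have [w0 wE] := sq 2 3 isT isT.
rewrite /= in xE yE wE.
have d_neq1 : d != 1.
  by apply: contraTneq uniq_s => ->; rewrite /= !inE eqxx !orbT.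
have [|z [z_ge0 dE]] := @double_square k (d - 1) y hk.
  by rewrite [y ^+ 2]expr2 -yE; ring.
have {}dE : d = 2 * z ^+ 2 + 1 by lia.
have wz : `|w0| ^+ 2 = 2 * (8 * k ^+ 2 + 1) * z ^+ 2 + 1.
  by rewrite real_normK ?num_real // [w0 ^+ 2]expr2 -wE dE; ring.
have xz : x ^+ 2 = 2 * z ^+ 2 + 1 - 8 * k ^+ 2.
  by rewrite [x ^+ 2]expr2 -xE dE; ring.
have [A [B [zAB [] [_ AB]]]] := pell_param _ _ _ hk (normr_ge0 w0) z_ge0 wz.
  (* In x^2 = 4 N A^2 B^2 + 2 - (N + 1), writing 2 as 2 (N + 1) A^2 - 2 N B^2 gives the factors. *)
  have [|||q qE] := @coprimez_mul_square (2 * A ^+ 2 - 1)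
      ((4 * k * B) ^+ 2 + 8 * k ^+ 2 + 1) x.
  - (* For v := (4 k B)^2 + 8 k^2 + 1, t is (v^2 - 1) / (16 k^2). *)
    apply/coprimezP; set t : int :=
      16 * k ^+ 2 * B ^+ 4 + 2 * (8 * k ^+ 2 + 1) * B ^+ 2 + 4 * k ^+ 2 + 1.
    exists (t * (8 * k ^+ 2 + 1), (4 * k * B) ^+ 2 + 8 * k ^+ 2 + 1 - t).
    apply: (eq_of_multiple (2 * t) AB).
    by rewrite /t /=; ring.
  - by rewrite !addr_ge0 ?sqr_ge0 ?mulr_ge0 ?(ltW hk).
  - by rewrite xz zAB; apply: (eq_of_multiple 2 AB); ring.
  have [A_eq B_eq] :=
    small_pell_solution _ _ _ hk (normr_le_of_sqr_sum _ _ _ hk qE) AB.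
  have z_eq : z ^+ 2 = 16 * k ^+ 2.
    by rewrite zAB !exprMn A_eq B_eq; ring.
  split; first by rewrite dE z_eq; ring.
  by exists x; rewrite -[x * x]expr2 xz z_eq; ring.
have [|||q qE] := @coprimez_mul_square
    (2 * (8 * k ^+ 2 + 1) * (8 * k ^+ 2) * B ^+ 2 + 1 - 8 * k ^+ 2)
    ((4 * k * B) ^+ 2 + 1) x.
(* For the factors u and v, u - (N + 1) v = -2 N, and 2 N B^2 = v - 1. *)
- apply/coprimezP; exists (B ^+ 2, 1 - B ^+ 2 * (8 * k ^+ 2 + 1)).
  by rewrite /=; ring.
- by rewrite addr_ge0 ?sqr_ge0.
- rewrite xz zAB.
  by apply: (eq_of_multiple (- (32 * k ^+ 2 * B ^+ 2)) AB); ring.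
have B0 := sqr_succ_eq_sqr _ _ qE.
by case/eqP: d_neq1; rewrite dE zAB mulrAC B0; ring.
Qed.
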